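(* Let $\mathbf{X}$ and $\mathbf{Y}$ be two-dimensional random vectors with $\mathbf{X}\succ_{d}\mathbf{Y}$. Then for every $u\in\mathcal{U}$ satisfying $\frac{\partial^2 u(x_1,x_2)}{\partial x_1\partial x_2}\le 0$ (everywhere), $\mathbb{E}\,u(\mathbf{X})>\mathbb{E}\,u(\mathbf{Y})$.
   Context: For $\mathbf{x},\mathbf{y}\in\mathbb{R}^2$ write $\mathbf{y}\preceq_p\mathbf{x}$ if $y_i\le x_i$ for all $i$, and $\mathbf{x}\succ_p\mathbf{y}$ (Pareto dominance) if $x_i\ge y_i$ for all $i$ and $x_i>y_i$ for some $i$. $\mathcal{U}$ is the class of strictly monotonically increasing functions $u:\mathbb{R}^2\to\mathbb{R}$, i.e. $\mathbf{x}\succ_p\mathbf{y}\implies u(\mathbf{x})>u(\mathbf{y})$. The CDF of a random vector is $F_{\mathbf{X}}(\mathbf{x})=P(\mathbf{X}\preceq_p\mathbf{x})$. $\mathbf{X}\succeq_{\mathrm{FSD}}\mathbf{Y}$ iff $F_{\mathbf{X}}(\mathbf{v})\le F_{\mathbf{Y}}(\mathbf{v})$ for all $\mathbf{v}$; $\mathbf{X}\succ_{\mathrm{FSD}}\mathbf{Y}$ iff additionally $F_{\mathbf{X}}(\mathbf{v})<F_{\mathbf{Y}}(\mathbf{v})$ for some $\mathbf{v}$ (same for real random variables). Distributional dominance $\mathbf{X}\succ_d\mathbf{Y}$: $\mathbf{X}\succeq_{\mathrm{FSD}}\mathbf{Y}$ and $X_i\succ_{\mathrm{FSD}}Y_i$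 for some marginal index $i$. All expectations appearing are assumed to exist. *)

(* Defs.v *)
From HB Require Import structures.
From mathcomp Require Import all_boot all_order all_algebra.
From mathcomp Require Import all_classical all_reals all_analysis.
Set Implicit Arguments. Unset Strict Implicit. Unset Printing Implicit Defensive.
Import Order.TTheory GRing.Theory Num.Theory.
Local Open Scope classical_set_scope.
Local Open Scope ring_scope.

(* A two-dimensional random vector X = (X1, X2) on a probability space P is
   represented by its two (measurable) coordinate random variables. *)

Section defs.
Context {d : measure_display} {T : measurableType d} {R : realType}
  (P : probability T R).

Definition cdf2 (X1 X2 : T -> R) (v1 v2 : R) : \bar R :=
  P [set w | X1 w <= v1 /\ X2 w <= v2].

Definition cdf1 (X : T -> R) (v : R) : \bar R := P [set w | X w <= v].

Definition fsd2_ge (X1 X2 Y1 Y2 : T -> R) : Prop :=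
  forall v1 v2, (cdf2 X1 X2 v1 v2 <= cdf2 Y1 Y2 v1 v2)%E.

Definition fsd1_gt (X Y : T -> R) : Prop :=
  (forall v, (cdf1 X v <= cdf1 Y v)%E) /\ (exists v, (cdf1 X v < cdf1 Y v)%E).

Definition dist_dom (X1 X2 Y1 Y2 : T -> R) : Prop :=
  fsd2_ge X1 X2 Y1 Y2 /\ (fsd1_gt X1 Y1 \/ fsd1_gt X2 Y2).
End defs.

Definition pareto_gt {R : realType} (x1 x2 y1 y2 : R) : Prop :=
  y1 <= x1 /\ y2 <= x2 /\ (y1 < x1 \/ y2 < x2).

Definition strictly_increasing2 {R : realType} (u : R -> R -> R) : Prop :=
  forall x1 x2 y1 y2, pareto_gt x1 x2 y1 y2 -> u y1 y2 < u x1 x2.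

Definition partial2 {R : realType} (u : R -> R -> R) (x1 x2 : R) : R :=
  derive1 (fun t => u x1 t) x2.

Definition mixed_partial {R : realType} (u : R -> R -> R) (x1 x2 : R) : R :=
  derive1 (fun s => partial2 u s x2) x1.

Definition mixed_partial_nonpos {R : realType} (u : R -> R -> R) : Prop :=
  forall x1 x2,
    derivable (fun t => u x1 t) x2 1 /\
    derivable (fun s => partial2 u s x2) x1 1 /\
    mixed_partial u x1 x2 <= 0.

(* Main.v *)
Require Import Defs.
From HB Require Import structures.
From mathcomp Require Import all_boot all_order all_algebra.
From mathcomp Require Import all_classical all_reals all_analysis.
From mathcomp Require Import measurable_realfun ring lra.
Import Order.TTheory GRing.Theory Num.Theory.
Import numFieldNormedType.Exports.
Local Open Scope classical_set_scope.
Local Open Scope ring_scope.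

(** The mixed partial condition says that [u] has decreasing differences, so on
    a bounded box [-u] is, up to a constant, a mixture of indicators of closed
    lower orthants with nonnegative weights; [F_X <= F_Y] then gives
    [E u(X) >= E u(Y)] for the truncated [u].  No smoothness in [x1] is
    available, so the mixture is discretized in [x2] only, where [u] is
    continuous.

    The truncation is removed by dominated convergence, which is delicate because
    only [u(X)] and [u(Y)] are integrable, not their marginal parts: as for
    [E (X1 + X2)] with [X1] and [X2] not integrable, the box corners
    [(b1, a2)] and [(a1, b2)] must be chosen together, so that clamping to the box
    increases [|u|] by at most a constant.

    Strictness is obtained by applying the weak inequality to the law of [X] plus
    a small atom at a point [p] and the law of [Y] plus the same atom at a larger
    point [q], which are still ordered because of the strict gap between
    marginals. *)

(** * Clamping and staircase approximation *)

Definition clamp {R : realType} (a b x : R) : R := Num.max a (Num.min b x).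

Lemma clampP (R : realType) (a b x : R) : a <= b ->
  [\/ x <= a /\ clamp a b x = a, a <= x <= b /\ clamp a b x = x |
      b <= x /\ clamp a b x = b].
Proof.
move=> ab; rewrite /clamp /Num.max /Num.min.
have [bx|xb] := ltP b x; last first.
  by have [ax|xa] := ltP a x; [constructor 2; rewrite (ltW ax)|constructor 1].
constructor 3; split; first exact: ltW.
by have [//|ba] := ltP a b; apply/eqP; rewrite eq_le ab ba.
Qed.

Lemma clamp_bounds (R : realType) (a b x : R) : a <= b -> a <= clamp a b x <= b.
Proof.
by move=> ab; case: (@clampP _ a b x ab) => -[h ->]; rewrite ?lexx ?ab.
Qed.

Lemma clamp_le (R : realType) (a b x y : R) : a <= b -> x <= y ->
  clamp a b x <= clamp a b y.
Proof.
move=> ab xy.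
case: (@clampP _ a b x ab) => -[hx ->]; case: (@clampP _ a b y ab) => -[hy ->];
  lra.
Qed.

Lemma clampK (R : realType) (a b x : R) : a <= b ->
  clamp a b (clamp a b x) = clamp a b x.
Proof.
move=> ab; have := clamp_bounds _ a b x ab; set y := clamp a b x => yab.
case: (@clampP _ a b y ab) => -[h ->] //; lra.
Qed.

Lemma clamp_id (R : realType) (a b x : R) : a <= x <= b -> clamp a b x = x.
Proof.
move=> xab; have ab : a <= b by lra.
by case: (@clampP _ a b x ab) => -[h ->] //; lra.
Qed.

Lemma continuous_clamp (R : realType) (a b : R) : continuous (clamp a b).
Proof.
move=> x; apply: (@continuous_max _ _ (cst a) (fun x => Num.min b x)).
  exact: cvg_cst.
apply: (@continuous_min _ _ (cst b) id); [exact: cvg_cst|exact: cvg_id].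
Qed.

(** The sum telescopes: the indicators switch on at the first [t j] not below [x], so everything
    cancels except [g] at that point. In the induction, the last term either replaces [g (t m.+1)]
    by [g (t m)] or vanishes together with all earlier ones. *)
Lemma staircase_sum (R : realType) (g : R -> R) (t : nat -> R) (x : R)
    (m : nat) :
  {homo t : i j / (i <= j)%N >-> i <= j} ->
  let S := g (t m) + \sum_(j < m) (g (t j) - g (t j.+1)) * (x <= t j)%R%:R in
  [/\ x <= t 0%N -> S = g (t 0%N), t m <= x -> S = g (t m) &
    t 0%N < x <= t m ->
      exists2 k, (k < m)%N & t k < x <= t k.+1 /\ S = g (t k.+1)].
Proof.
move=> tnd; elim: m => [|m IH] /=.
  rewrite big_ord0 addr0; split => //; lra.
rewrite big_ord_recr /=; move: IH; set s := \sum_(i < m) _ => -[IH1 IH2 IH3].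
have tS : t m <= t m.+1 by exact: tnd.
have t0 : t 0%N <= t m by exact: tnd.
have [xm|mx] := leP x (t m).
  rewrite mulr1 (_ : _ + _ = g (t m) + s); last by ring.
  split => // [mx|/andP[x0 _]]; last first.
    by have [|k km H] := IH3; [rewrite x0|exists k => //; exact: ltnW].
  have xE : x = t m by lra.
  have tE : t m.+1 = t m by lra.
  by rewrite tE IH2// xE.
rewrite mulr0 addr0.
have -> : s = 0 by have := IH2 (ltW mx); lra.
rewrite addr0; split => // [|/andP[x0 xm]]; first by lra.
by exists m => //; split => //; rewrite mx xm.
Qed.

Definition grid {R : realType} (a b : R) (m j : nat) : R :=
  a + j%:R * ((b - a) / m.+1%:R).

(** Summation by parts of a step interpolation of [g]: for nonincreasing [g] all weights are
    nonnegative, so integrals reduce to measures of lower half-lines. *)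
Definition staircase {R : realType} (a b : R) (g : R -> R) (m : nat)
    (x : R) : R :=
  g b + \sum_(j < m.+1)
    (g (grid a b m j) - g (grid a b m j.+1)) * (x <= grid a b m j)%R%:R.

Lemma grid_last (R : realType) (a b : R) m : grid a b m m.+1 = b.
Proof. by rewrite /grid mulrCA divff ?pnatr_eq0// mulr1 addrC subrK. Qed.

Lemma grid_nd (R : realType) (a b : R) m : a <= b ->
  {homo grid a b m : i j / (i <= j)%N >-> i <= j}.
Proof.
move=> ab i j ij; rewrite /grid lerD2l ler_wpM2r ?ler_nat//.
by rewrite divr_ge0 ?subr_ge0.
Qed.

(** The point [y] is the first grid point not below [x], or an endpoint outside the interval. That
    the staircase is a value of [g] transfers bounds on [g]; the mesh estimate gives convergence. *)
Lemma staircase_val (R : realType) (a b : R) (g : R -> R) (m : nat) (x : R) :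
  a <= b -> exists y, staircase a b g m x = g y /\
    `|clamp a b x - y| <= (b - a) / m.+1%:R.
Proof.
move=> ab; have := @staircase_sum _ g _ x m.+1 (grid_nd _ a b m ab).
rewrite /staircase/= grid_last; set S := g b + _.
have g0 : grid a b m 0 = a by rewrite /grid mul0r addr0.
have h0 : 0 <= (b - a) / m.+1%:R by rewrite divr_ge0 ?subr_ge0.
have gS j : grid a b m j.+1 = grid a b m j + (b - a) / m.+1%:R.
  by rewrite /grid -natr1 mulrDl mul1r addrA.
rewrite g0 => -[H1 H2 H3].
move: ((b - a) / m.+1%:R) h0 gS => h h0 gS.
have [xa|ax] := leP x a.
  exists a; split; first exact: H1.
  case: (@clampP _ a b x ab) => -[hx ->]; rewrite ler_norml; lra.
have [bx|xb] := leP b x.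
  exists b; split; first exact: H2.
  case: (@clampP _ a b x ab) => -[hx ->]; rewrite ler_norml; lra.
have [|k km [kx ->]] := H3; first by rewrite ax ltW.
exists (grid a b m k.+1); split=> //.
rewrite clamp_id; last by rewrite !ltW.
move: kx; rewrite gS ler_norml; lra.
Qed.

Lemma cvg_staircase (R : realType) (a b : R) (g : R -> R) (x : R) :
  a <= b -> continuous g -> g (clamp a b x) = g x ->
  (fun m => staircase a b g m x) @ \oo --> g x.
Proof.
move=> ab cg <-.
have /choice[y yP] m := staircase_val _ a b g m x ab.
have -> : (fun m => staircase a b g m x) = g \o y.
  by apply/funext => m; rewrite (yP m).1.
apply: continuous_cvg; first exact: cg.
apply: (@squeeze_cvgr _ _ _ _ (fun m : nat => clamp a b x - (b - a) / m.+1%:R)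
  (fun m : nat => clamp a b x + (b - a) / m.+1%:R)).
- apply: nearW => m; have := (yP m).2; move: (_ / _) => h.
  by rewrite ler_norml; lra.
- rewrite -[X in _ --> X]subr0; apply: cvgB; first exact: cvg_cst.
  rewrite -(mulr0 (b - a)); apply: cvgMr; exact: cvg_harmonic.
- rewrite -[X in _ --> X]addr0; apply: cvgD; first exact: cvg_cst.
  rewrite -(mulr0 (b - a)); apply: cvgMr; exact: cvg_harmonic.
Qed.

(** * Truncation boxes *)

Definition nondecreasing2 {R : realType} (u : R -> R -> R) : Prop :=
  forall x1 x2 y1 y2, y1 <= x1 -> y2 <= x2 -> u y1 y2 <= u x1 x2.

(** Submodularity: the derivative-free form of a nonpositive mixed partial. *)
Definition decreasing_differences {R : realType} (u : R -> R -> R) : Prop :=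
  forall s s' t t', s <= s' -> t <= t' -> u s' t' - u s t' <= u s' t - u s t.

Lemma nondecreasing2_swap {R : realType} (u : R -> R -> R) :
  nondecreasing2 u -> nondecreasing2 (fun s t => u t s).
Proof. by move=> und x1 x2 y1 y2 h1 h2; rewrite und. Qed.

Lemma decreasing_differences_swap {R : realType} (u : R -> R -> R) :
  decreasing_differences u -> decreasing_differences (fun s t => u t s).
Proof. by move=> udd s s' t t' ss tt; have := udd _ _ _ _ tt ss; lra. Qed.

(** The point [(b, a)] is the lower right corner of a box. The clauses treat points clamped from the
    right, from below and from both sides; in the first two, monotonicity already supplies the
    opposite bound. *)
Definition box_corner {R : realType} (u : R -> R -> R) (C b a : R) : Prop :=
  [/\ forall x1 x2, b <= x1 -> a <= x2 -> - `|u x1 x2| - C <= u b x2,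
      forall x1 x2, x1 <= b -> x2 <= a -> u x1 a <= `|u x1 x2| + C &
      forall x1 x2, b <= x1 -> x2 <= a -> `|u b a| <= `|u x1 x2| + C].

(** With [a] below [c], the section at height [a] has a finite supremum, and [b] is taken where it
    is attained up to 1. By decreasing differences, moving right from [b] at any height above [a]
    then gains at most 1. *)
Lemma box_corner_bounded_above {R : realType} (u : R -> R -> R) (c K n : R) :
  nondecreasing2 u -> decreasing_differences u -> (forall s, u s c <= K) ->
  exists b a, [/\ n <= b, a <= - n & box_corner u (`|K| + 1) b a].
Proof.
move=> und udd uK; pose a := Num.min (- n) c.
have an : a <= - n by rewrite ge_min lexx.
have ac : a <= c by rewrite ge_min lexx orbT.
have uaK s : u s a <= K by apply: (le_trans _ (uK s)); apply und.
have [b0 b0P] : exists b0, forall s, u s a <= u b0 a + 1.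
  have supE : has_sup (range (u ^~ a)).
    by split; [exists (u 0 a), 0|exists K => _ [s _ <-]; exact: uaK].
  have [_ [b0 _ <-] hb] := sup_adherent ltr01 supE.
  exists b0 => s; have : u s a <= sup (range (u ^~ a)).
    by apply: ub_le_sup; [exact: supE.2|exists s].
  lra.
pose b := Num.max n b0.
have nb : n <= b by rewrite le_max lexx.
have bP s : u s a <= u b a + 1.
  apply: (le_trans (b0P s)); rewrite lerD2r; apply und => //.
  by rewrite le_max lexx orbT.
exists b, a; split=> //; split => x1 x2 h1 h2.
- have := udd _ _ _ _ h1 h2; have := bP x1; have := ler_norm (- u x1 x2).
  by rewrite normrN; have := normr_ge0 K; lra.
- have := uaK x1; have := ler_norm K; have := normr_ge0 (u x1 x2); lra.
- have := uaK b; have := ler_norm K; have := normr_ge0 (u x1 x2).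
  have := und _ _ _ _ (lexx x1) h2; have := bP x1; have := ler_norm (- u x1 x2).
  by rewrite normrN ler_norml; have := normr_ge0 K; lra.
Qed.

(** To the right of [c], raising the second coordinate to [- n] gains at most what it gains on the
    line through [c], that is at most [u c 0 - K]. Comparing with [u c 0] keeps the constant
    independent of [n]. *)
Lemma box_corner_bounded_below {R : realType} (u : R -> R -> R) (c K n : R) :
  nondecreasing2 u -> decreasing_differences u -> (forall t, K <= u c t) ->
  0 <= n ->
  exists b a, [/\ n <= b, a <= - n & box_corner u (`|K| + `|u c 0|) b a].
Proof.
move=> und udd uK n0; pose b := Num.max n c.
have nb : n <= b by rewrite le_max lexx.
have cb : c <= b by rewrite le_max lexx orbT.
have ubK t : K <= u b t by apply: (le_trans (uK t)); apply und.
have Ka := ler_norm (- K); rewrite normrN in Ka.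
have ca := ler_norm (u c 0); have c0 := normr_ge0 (u c 0).
have K0 := normr_ge0 K.
exists b, (- n); split=> //; split => x1 x2 h1 h2.
- by have := ubK x2; have := normr_ge0 (u x1 x2); lra.
- have cn : u c (- n) <= u c 0 by apply und; lra.
  have [cx|xc] := leP c x1.
    have := udd _ _ _ _ cx h2; have := uK x2; have := ler_norm (u x1 x2); lra.
  have := und _ _ _ _ (ltW xc) (lexx (- n)); have := normr_ge0 (u x1 x2); lra.
- have cn : u c (- n) <= u c 0 by apply und; lra.
  have := udd _ _ _ _ cb h2; have := uK x2; have := ler_norm (u x1 x2).
  have := ubK (- n); have := und _ _ _ _ h1 (lexx x2).
  have := normr_ge0 (u x1 x2).
  rewrite (ler_norml (u b _)); lra.
Qed.

Lemma box_corner_zero {R : realType} (u : R -> R -> R) (b a : R) :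
  nondecreasing2 u -> u b a = 0 -> box_corner u 0 b a.
Proof.
move=> und u0; split => x1 x2 h1 h2.
- have := und _ _ _ _ (lexx b) h2; have := normr_ge0 (u x1 x2); lra.
- have := und _ _ _ _ h1 (lexx a); have := normr_ge0 (u x1 x2); lra.
- by rewrite u0 normr0 addr0.
Qed.

Lemma box_cornerW {R : realType} (u : R -> R -> R) (C C' b a : R) :
  C <= C' -> box_corner u C b a -> box_corner u C' b a.
Proof.
move=> CC [H1 H2 H3]; split=> x1 x2 h1 h2.
- have := H1 _ _ h1 h2; lra.
- have := H2 _ _ h1 h2; lra.
- have := H3 _ _ h1 h2; lra.
Qed.

(** Either [u] is bounded above on a horizontal line, or bounded below on a vertical one, or neither
    holds and a corner with value zero is sought. That last step is a premise because [u] and its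
    swap obtain the zero differently, continuity being given in the second variable only. *)
Lemma box_corner_exists {R : realType} (u : R -> R -> R) :
  nondecreasing2 u -> decreasing_differences u ->
  ((forall t K, exists s, K < u s t) -> (forall s K, exists t, u s t < K) ->
    forall n, exists b a, [/\ n <= b, a <= - n & u b a = 0]) ->
  exists C, forall n, 0 <= n ->
    exists b a, [/\ n <= b, a <= - n & box_corner u C b a].
Proof.
move=> und udd u0.
have [[c [K uK]]|nI] := pselect (exists c K, forall s, u s c <= K).
  by exists (`|K| + 1) => n _; exact: (box_corner_bounded_above _ c).
have [[c [K uK]]|nII] := pselect (exists c K, forall t, K <= u c t).
  by exists (`|K| + `|u c 0|) => n n0; exact: box_corner_bounded_below.
exists 0 => n _; have [||b [a [nb an uba]]] := u0 _ _ n.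
- move=> t K; apply: contrapT => /forallNP h; apply: nI; exists t, K => s.
  by rewrite leNgt; apply/negP/h.
- move=> s K; apply: contrapT => /forallNP h; apply: nII; exists s, K => t.
  by rewrite leNgt; apply/negP/h.
by exists b, a; split => //; exact: box_corner_zero.
Qed.

Lemma continuous_corner_value0 {R : realType} (u : R -> R -> R) :
  nondecreasing2 u -> (forall s, continuous (u s)) ->
  (forall t K, exists s, K < u s t) -> (forall s K, exists t, u s t < K) ->
  forall n, exists b a, [/\ n <= b, a <= - n & u b a = 0].
Proof.
(* First [b] is fixed with [u b (- n)] positive; then [a] is lowered by the intermediate value
   theorem. *)
move=> und uc up dn n; have [b0 b0P] := up (- n) 0.
pose b := Num.max n b0; have [a0 a0P] := dn b 0.
have ub0 : 0 < u b (- n).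
  by apply: (lt_le_trans b0P); apply und => //; rewrite le_max lexx orbT.
have an : a0 <= - n.
  rewrite leNgt; apply/negP => /ltW na.
  have := und _ _ _ _ (lexx b) na; lra.
have [|||a + ua] := @IVT R (u b) a0 (- n) 0 => //.
- exact/continuous_subspaceT/uc.
- by rewrite ge_min le_max (ltW a0P) (ltW ub0) orbT.
rewrite in_itv/= => /andP[_ aln].
by exists b, a; split => //; rewrite le_max lexx.
Qed.

(** The zero must again be found along the second variable, so here the lower end [a] is fixed first
    and the upper end [b] is raised. *)
Lemma continuous_corner_value0_swap {R : realType} (u : R -> R -> R) :
  nondecreasing2 u -> (forall s, continuous (u s)) ->
  (forall s K, exists t, K < u s t) -> (forall t K, exists s, u s t < K) ->
  forall n, exists b a, [/\ n <= b, a <= - n & u a b = 0].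
Proof.
move=> und uc up dn n; have [a0 a0P] := dn n 0.
pose a := Num.min (- n) a0; have [b0 b0P] := up a 0.
have ua0 : u a n < 0.
  by apply: (le_lt_trans _ a0P); apply und => //; rewrite ge_min lexx orbT.
have nb : n <= b0.
  rewrite leNgt; apply/negP => /ltW bn.
  have := und _ _ _ _ (lexx a) bn; lra.
have [|||b + ub] := @IVT R (u a) n b0 0 => //.
- exact/continuous_subspaceT/uc.
- by rewrite ge_min le_max (ltW ua0) (ltW b0P) orbT.
rewrite in_itv/= => /andP[nlb _].
by exists b, a; split => //; rewrite ge_min lexx.
Qed.

Lemma dominating_boxes {R : realType} (u : R -> R -> R) :
  nondecreasing2 u -> decreasing_differences u -> (forall s, continuous (u s)) ->
  exists C, forall n, 0 <= n -> exists a1 b1 a2 b2,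
    [/\ a1 <= - n, n <= b1, a2 <= - n, n <= b2 & forall x1 x2,
      `|u (clamp a1 b1 x1) (clamp a2 b2 x2)| <= `|u x1 x2| + C].
Proof.
move=> und udd uc.
have [C CP] := box_corner_exists u und udd (continuous_corner_value0 u und uc).
have [C' C'P] := box_corner_exists _ (nondecreasing2_swap u und)
  (decreasing_differences_swap u udd) (continuous_corner_value0_swap u und uc).
exists (`|C| + `|C'| + `|u 0 0|) => n n0.
have [b1 [a2 [nb1 a2n c1]]] := CP n n0; have [b2 [a1 [nb2 a1n c2]]] := C'P n n0.
exists a1, b1, a2, b2; split => // x1 x2.
have {c1}[P1 P2 P3] : box_corner u `|C| b1 a2.
  by apply: box_cornerW c1; exact: ler_norm.
have {c2}[Q1 Q2 Q3] : box_corner (fun s t => u t s) `|C'| b2 a1.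
  by apply: box_cornerW c2; exact: ler_norm.
(* At the upper right and lower left corners, monotonicity gives one bound and comparison with the
   origin gives the other. *)
have ub b b' : 0 <= b -> 0 <= b' -> - `|u 0 0| <= u b b'.
  move=> b0 b'0; have := und _ _ _ _ b0 b'0; have := ler_norm (- u 0 0).
  by rewrite normrN; lra.
have ua a a' : a <= 0 -> a' <= 0 -> u a a' <= `|u 0 0|.
  by move=> a0 a'0; have := und _ _ _ _ a0 a'0; have := ler_norm (u 0 0); lra.
have C0 := normr_ge0 C; have C'0 := normr_ge0 C'; have u0 := normr_ge0 (u 0 0).
have x0 := normr_ge0 (u x1 x2).
have xP : u x1 x2 <= `|u x1 x2| by exact: ler_norm.
have xN : - `|u x1 x2| <= u x1 x2 by rewrite lerNl -normrN; exact: ler_norm.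
have ab1 : a1 <= b1 by lra.
have ab2 : a2 <= b2 by lra.
(* Nine regions of the plane relative to the box; [P1] to [P3] serve its lower right corner, [Q1] to
   [Q3] its upper left one. *)
case: (@clampP _ a1 b1 x1 ab1) => -[h1 ->];
  case: (@clampP _ a2 b2 x2 ab2) => -[h2 ->].
- have := und _ _ _ _ h1 h2; have := ua a1 a2; rewrite ler_norml; lra.
- case/andP: h2 => h2 h2'; have := und _ _ _ _ h1 (lexx x2).
  by have := Q2 x2 x1 h2' h1; rewrite ler_norml; lra.
- by have := Q3 x2 x1 h2 h1; lra.
- case/andP: h1 => h1 h1'; have := und _ _ _ _ (lexx x1) h2.
  by have := P2 x1 x2 h1' h2; rewrite ler_norml; lra.
- by lra.
- case/andP: h1 => h1 h1'; have := und _ _ _ _ (lexx x1) h2.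
  by have := Q1 x2 x1 h2 h1; rewrite ler_norml; lra.
- by have := P3 x1 x2 h1 h2; lra.
- case/andP: h2 => h2 h2'; have := und _ _ _ _ h1 (lexx x2).
  by have := P1 x1 x2 h1 h2; rewrite ler_norml; lra.
- have := und _ _ _ _ h1 h2; have := ub b1 b2; rewrite ler_norml; lra.
Qed.

(** * Monotonicity, decreasing differences and continuity of [u] *)

Lemma strictly_increasing2_nondecreasing {R : realType} (u : R -> R -> R) :
  strictly_increasing2 u -> nondecreasing2 u.
Proof.
move=> uincr x1 x2 y1 y2 h1 h2.
have [e1|l1] := eqVneq y1 x1; last first.
  by apply/ltW/uincr; split => //; split => //; left; rewrite lt_neqAle l1.
have [e2|l2] := eqVneq y2 x2; first by rewrite e1 e2.
by apply/ltW/uincr; split => //; split => //; right; rewrite lt_neqAle l2.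
Qed.

(** The sign of a derivative is integrated twice: first in [s], making [partial2 u] nonincreasing
    there, then in [t] for the difference of two sections. *)
Lemma mixed_partial_nonpos_decreasing_differences {R : realType}
    (u : R -> R -> R) : mixed_partial_nonpos u -> decreasing_differences u.
Proof.
move=> um s s' t t' ss tt.
have pn r : partial2 u s' r <= partial2 u s r.
  apply: (@ler0_derive1_nincr _ (fun s => partial2 u s r) s s') => //.
  - by move=> x _; have [_ []] := um x r.
  - by move=> x _; have [_ [_]] := um x r.
  - apply: derivable_within_continuous => x _; by have [_ []] := um x r.
have d q r : derivable (fun t => u q t) r 1 by have [] := um q r.
apply: (@ler0_derive1_nincr _ (fun t => u s' t - u s t) t t') => //.
- by move=> x _; apply: derivableB.
- move=> x _; rewrite derive1E deriveB// -!derive1E subr_le0; exact: pn.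
- by apply: derivable_within_continuous => x _; apply: derivableB.
Qed.

Lemma mixed_partial_nonpos_continuous {R : realType} (u : R -> R -> R) :
  mixed_partial_nonpos u -> forall s, continuous (u s).
Proof.
move=> um s t; apply/differentiable_continuous/derivable1_diffP.
by have [] := um s t.
Qed.

(** * Comparison of integrals of mixtures *)

Lemma measurable_fun_le_cst {d} {T : measurableType d} {R : realType}
    (A : T -> R) (s : R) : measurable_fun setT A ->
  measurable [set x | A x <= s].
Proof.
move=> mA; rewrite (_ : [set _ | _] = A @^-1` `]-oo, s]).
  by rewrite -[X in measurable X]setTI; exact: mA.
by apply/seteqP; split=> x /=; rewrite in_itv.
Qed.

Lemma measurable_fun_indic_le {d} {T : measurableType d} {R : realType}
    (A : T -> R) (s : R) : measurable_fun setT A ->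
  measurable_fun setT (fun x => (A x <= s)%R%:R : R).
Proof.
move=> mA; rewrite (_ : (fun _ => _) = \1_[set x | A x <= s]).
  apply: measurable_indic; exact: measurable_fun_le_cst.
by apply/funext => x; rewrite indicE; congr ((nat_of_bool _)%:R);
  apply/idP/idP; rewrite inE.
Qed.

Lemma measurable_staircase {d} {T : measurableType d} {R : realType}
    (a b : R) (w : T -> R -> R) (A : T -> R) (m : nat) :
  measurable_fun setT A -> (forall t, measurable_fun setT (w^~ t)) ->
  measurable_fun setT (fun x => staircase a b (w x) m (A x)).
Proof.
move=> mA mw; apply: measurable_funD; first exact: mw.
apply: measurable_sum => j; apply: measurable_funM.
  exact: measurable_funB.
exact: measurable_fun_indic_le.
Qed.

(** A function measurable in [x] and continuous in [t] is evaluated at a measurable [A x]: it is a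
    pointwise limit of staircases, each visibly measurable. *)
Lemma measurable_section_comp {d} {T : measurableType d} {R : realType}
    (a b : R) (w : T -> R -> R) (A : T -> R) : a <= b ->
  measurable_fun setT A -> (forall t, measurable_fun setT (w^~ t)) ->
  (forall x, continuous (w x)) -> (forall x t, w x (clamp a b t) = w x t) ->
  measurable_fun setT (fun x => w x (A x)).
Proof.
move=> ab mA mw cw wc.
apply: (@measurable_fun_cvg _ _ _ _ (fun m x => staircase a b (w x) m (A x))).
  by move=> m; exact: measurable_staircase.
by move=> x _; exact: cvg_staircase.
Qed.

Section finite_mass.
Context {d} {T : measurableType d} {R : realType}.
Variables (m1 m2 : {measure set T -> \bar R}).
Hypotheses (m1oo : (m1 setT < +oo)%E) (m2oo : (m2 setT < +oo)%E).

Lemma bounded_integrable (m : {measure set T -> \bar R}) (D : set T)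
    (f : T -> R) (K : R) : (m setT < +oo)%E -> measurable D ->
  measurable_fun setT f -> (forall x, `|f x| <= K) ->
  m.-integrable D (EFin \o f).
Proof.
move=> moo mD mf fK; apply: (integrableS measurableT) => //.
apply: (@le_integrable _ _ _ _ _ _ _ (EFin \o cst K)) => //.
- exact/measurable_EFinP.
- move=> x _ /=; rewrite lee_fin (le_trans (fK x))//; exact: ler_norm.
- apply/integrableP; split; first exact/measurable_EFinP.
  rewrite (_ : (fun _ => _) = cst (`|K|%:E)); last by [].
  by rewrite integral_cst// lte_mul_pinfty.
Qed.

Lemma staircase_integral (D : set T) (a b : R) (w : T -> R -> R) (A : T -> R)
    (m : {measure set T -> \bar R}) n :
  a <= b -> measurable D ->
  measurable_fun setT A -> (forall t, measurable_fun setT (w^~ t)) ->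
  (forall x t, 0 <= w x t) -> (forall x, {homo w x : s t / s <= t >-> t <= s}) ->
  (\int[m]_(x in D) (staircase a b (w x) n (A x))%:E =
   \int[m]_(x in D) (w x b)%:E +
   \sum_(j < n.+1) \int[m]_(x in D `&` [set x | (A x <= grid a b n j)%R])
     (w x (grid a b n j) - w x (grid a b n j.+1))%:E)%E.
Proof.
move=> ab mD mA mw w0 wd.
have gd j : grid a b n j <= grid a b n j.+1 by exact: grid_nd.
under eq_integral => x _ do rewrite /staircase EFinD -sumEFin.
rewrite ge0_integralD//=; last 4 first.
- by move=> x _; rewrite lee_fin.
- apply/measurable_EFinP; exact: measurable_funS (mw b).
- move=> x _; rewrite sume_ge0// => j _; rewrite lee_fin mulr_ge0// subr_ge0.
  exact: wd.
- apply: emeasurable_sum => j; apply/measurable_EFinP.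
  apply: (@measurable_funS _ _ _ _ setT) => //.
  apply: measurable_funM; first exact: measurable_funB.
  exact: measurable_fun_indic_le.
congr (_ + _)%E; rewrite ge0_integral_sum//=; last 2 first.
- move=> j; apply/measurable_EFinP; apply: (@measurable_funS _ _ _ _ setT) => //.
  apply: measurable_funM; first exact: measurable_funB.
  exact: measurable_fun_indic_le.
- by move=> j x _; rewrite lee_fin mulr_ge0// subr_ge0; exact: wd.
apply: eq_bigr => j _; rewrite [RHS]integral_mkcondr.
apply: eq_integral => x _; rewrite patchE.
case: ifPn => [/[!inE]/= ->|]; first by rewrite mulr1.
by rewrite notin_setE/= => /negP/negbTE ->; rewrite mulr0.
Qed.

(** Each staircase integral is a sum of the compared terms, and the constant [K] dominates the
    passage to the limit. The threshold on [A] moves into the domain, so the remaining integrands no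
    longer involve [A]: this removes one variable. *)
Lemma le_integral_staircase (D : set T) (a b K : R) (w : T -> R -> R)
    (A : T -> R) :
  a <= b -> measurable D ->
  measurable_fun setT A -> (forall t, measurable_fun setT (w^~ t)) ->
  (forall x t, 0 <= w x t <= K) ->
  (forall x, {homo w x : s t / s <= t >-> t <= s}) ->
  (forall x, continuous (w x)) -> (forall x t, w x (clamp a b t) = w x t) ->
  (\int[m1]_(x in D) (w x b)%:E <= \int[m2]_(x in D) (w x b)%:E)%E ->
  (forall s t, s <= t ->
    (\int[m1]_(x in D `&` [set x | (A x <= s)%R]) (w x s - w x t)%:E <=
     \int[m2]_(x in D `&` [set x | (A x <= s)%R]) (w x s - w x t)%:E)%E) ->
  (\int[m1]_(x in D) (w x (A x))%:E <= \int[m2]_(x in D) (w x (A x))%:E)%E.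
Proof.
move=> ab mD mA mw wK wd wc wcl leb lest.
have w0 x t : 0 <= w x t by case/andP: (wK x t).
have cvg (m : {measure set T -> \bar R}) : (m setT < +oo)%E ->
    (fun n => \int[m]_(x in D) (staircase a b (w x) n (A x))%:E)%E @ \oo -->
    (\int[m]_(x in D) (w x (A x))%:E)%E.
  move=> moo.
  have [//|//|//|//|//|_ _] := @dominated_convergence _ T R m D mD
    (fun n x => (staircase a b (w x) n (A x))%:E) (fun x => (w x (A x))%:E)
    (EFin \o cst K).
  - move=> n; apply/measurable_EFinP; apply: (@measurable_funS _ _ _ _ setT) => //.
    exact: measurable_staircase.
  - apply/measurable_EFinP; apply: (@measurable_funS _ _ _ _ setT) => //.
    exact: (measurable_section_comp a b).
  - apply: aeW => x _; apply: cvg_EFin; first exact: nearW.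
    exact: cvg_staircase.
  - apply: (bounded_integrable m D (cst K) `|K|) => //.
  - apply: aeW => x n _; rewrite lee_fin.
    by have [y [-> _]] := staircase_val _ a b (w x) n (A x) ab; rewrite ger0_norm//;
      case/andP: (wK x y).
  by [].
apply: (lee_cvg_to (cvg _ m1oo) (cvg _ m2oo)).
apply: nearW => n; rewrite !staircase_integral//.
by apply: leeD => //; apply: lee_sum => j _; apply: lest; exact: grid_nd.
Qed.

Lemma le_integral_superlevel (D : set T) (K : R) (f : T -> R) :
  measurable D -> measurable_fun setT f -> (forall x, 0 <= f x <= K) ->
  (forall r, (m1 (D `&` [set x | (r <= f x)%R]) <=
              m2 (D `&` [set x | (r <= f x)%R]))%E) ->
  (\int[m1]_(x in D) (f x)%:E <= \int[m2]_(x in D) (f x)%:E)%E.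
Proof.
move=> mD mf fK le12.
have K0 : 0 <= K by have /andP[] := fK point; exact: le_trans.
have NK : - K <= 0 by rewrite lerNl oppr0.
(* Superlevel sets of [f] are sublevel sets of [- f], so the layer-cake comparison is the staircase
   one with [A := - f] and a weight independent of [x]. *)
pose w (x : T) (t : R) := - clamp (- K) 0 t.
have fE x : f x = w x (- f x).
  by rewrite /w clamp_id ?opprK//; have := fK x; lra.
have mNf : measurable_fun setT (fun x => - f x) by exact: measurable_funN.
under eq_integral => x _ do rewrite fE.
under [leRHS]eq_integral => x _ do rewrite fE.
apply: (le_integral_staircase D (- K) 0 K) => //.
- by move=> x t; rewrite /w; have := clamp_bounds _ _ _ t NK; lra.
- by move=> x s t st; rewrite /w lerN2 clamp_le.
- move=> x t; rewrite /w; apply: continuousN; exact: continuous_clamp.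
- by move=> x t; rewrite /w clampK.
- rewrite /w clamp_id ?NK ?lexx// oppr0.
  by rewrite !integral0.
move=> s t st; rewrite /w.
set c := - clamp (- K) 0 s - _; have c0 : 0 <= c.
  by rewrite /c; have := clamp_le _ _ _ _ _ NK st; lra.
rewrite !integral_cst//; first last.
- by apply: measurableI => //; exact: measurable_fun_le_cst.
- by apply: measurableI => //; exact: measurable_fun_le_cst.
apply: lee_pmul => //.
by have := le12 (- s); under eq_set => x do rewrite lerNl.
Qed.

End finite_mass.

(** * The weak inequality in the lower orthant order *)

Definition down_closed {R : realType} (P : set R) : Prop :=
  forall x y, x <= y -> P y -> P x.

(** Such a set is the whole line, a closed half-line or an open one; the sequences are [n], the
    constant supremum, and the supremum minus [1 / (n + 1)]. The increasing union is what continuity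
    from below needs. *)
Lemma down_closed_bigcup {R : realType} (P : set R) :
  P !=set0 -> down_closed P ->
  exists2 c : nat -> R, {homo c : i j / (i <= j)%N >-> i <= j} &
    P = \bigcup_n [set x | x <= c n].
Proof.
move=> P0 Pd; have [ubP|nubP] := pselect (has_ubound P); last first.
  exists (fun n => n%:R) => [i j|]; first by rewrite ler_nat.
  apply/seteqP; split=> x.
    move=> _; exists (Num.truncn x).+1 => //=; exact/ltW/truncnS_gt.
  move=> _; apply: contrapT => nPx; apply: nubP; exists x => y Py.
  by rewrite leNgt; apply/negP => /ltW xy; apply: nPx; exact: Pd Py.
have supP : has_sup P by [].
have [PS|nPS] := pselect (P (sup P)).
  exists (cst (sup P)) => //; apply/seteqP; split=> x.
    by move=> Px; exists 0%N => //=; exact: ub_le_sup.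
  by move=> [_ _] /= xs; exact: Pd PS.
exists (fun n => sup P - n.+1%:R^-1) => [i j ij|].
  by rewrite lerD2l lerN2 lef_pV2 ?posrE ?ltr0n// ler_nat ltnS.
apply/seteqP; split=> [x Px|x [n _] /= xs].
  have xs : x < sup P.
    rewrite lt_neqAle ub_le_sup// andbT; apply/eqP => xE.
    by apply: nPS; rewrite -xE.
  exists (Num.truncn (sup P - x)^-1) => //=; rewrite lerBrDl -lerBrDr.
  rewrite -[leRHS]invrK lef_pV2 ?posrE ?ltr0n ?invr_gt0 ?subr_gt0//.
  exact/ltW/truncnS_gt.
have [|y Py] := @sup_adherent _ P n.+1%:R^-1 _ supP; first by [].
by move=> sy; apply: Pd Py; exact: (le_trans xs (ltW sy)).
Qed.

Lemma le_measure_down_closed {d} {T : measurableType d} {R : realType}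
    (m1 m2 : {measure set T -> \bar R}) (E : set T) (A : T -> R) (P : set R) :
  measurable E -> measurable_fun setT A -> down_closed P ->
  (forall s, (m1 (E `&` [set x | (A x <= s)%R]) <=
              m2 (E `&` [set x | (A x <= s)%R]))%E) ->
  (m1 (E `&` A @^-1` P) <= m2 (E `&` A @^-1` P))%E.
Proof.
move=> mE mA Pd le12; have [->|/set0P P0] := eqVneq P set0.
  by rewrite preimage_set0 setI0 !measure0.
have [c cnd ->] := down_closed_bigcup P P0 Pd.
rewrite preimage_bigcup setI_bigcupr.
pose F n := E `&` A @^-1` [set x | x <= c n].
have mF n : measurable (F n).
  by apply: measurableI => //; exact: measurable_fun_le_cst.
have ndF : nondecreasing_seq F.
  by move=> i j ij; apply/subsetPset; apply: setIS => x /= /le_trans; apply; exact: cnd.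
have cF (m : {measure set T -> \bar R}) := @nondecreasing_cvg_mu _ _ _ m F mF
  (bigcupT_measurable F mF) ndF.
by apply: (lee_cvg_to (cF m1) (cF m2)); apply: nearW => n; exact: le12.
Qed.

Section lower_orthant.
Context {R : realType}.
Variables (m1 m2 : {measure set (R * R) -> \bar R}).
Hypothesis le12 : forall s t,
  (m1 [set x | (x.1 <= s)%R /\ (x.2 <= t)%R] <=
   m2 [set x | (x.1 <= s)%R /\ (x.2 <= t)%R])%E.
Hypotheses (m1oo : (m1 setT < +oo)%E) (m12 : m1 setT = m2 setT).

Let m2oo : (m2 setT < +oo)%E. Proof. by rewrite -m12. Qed.

Let mfst : measurable_fun setT (fst : R * R -> R).
Proof. exact: measurable_fst. Qed.

Let msnd : measurable_fun setT (snd : R * R -> R).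
Proof. exact: measurable_snd. Qed.

Lemma le_orthant_snd_fst s t :
  (m1 ([set x | (x.2 <= t)%R] `&` [set x | (x.1 <= s)%R]) <=
   m2 ([set x | (x.2 <= t)%R] `&` [set x | (x.1 <= s)%R]))%E.
Proof. by have := le12 s t; rewrite -setIC. Qed.

Lemma le_orthant_fst s :
  (m1 (setT `&` [set x | (x.1 <= s)%R]) <= m2 (setT `&` [set x | (x.1 <= s)%R]))%E.
Proof.
rewrite setTI.
(* The whole line is down-closed, which amounts to sending the second threshold to infinity. *)
have := @le_measure_down_closed _ _ _ m1 m2 [set x | x.1 <= s] snd setT
  (measurable_fun_le_cst _ s mfst) msnd (fun _ _ _ _ => I) (le12 s).
by rewrite preimage_setT setIT.
Qed.

(** Superlevel sets of a nonincreasing [f] are down-closed, possibly open half-lines, so the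
    comparison on closed half-lines extends to them. *)
Lemma le_integral_marginal (E : set (R * R)) (K : R) (f : R -> R) :
  measurable E -> (forall x, 0 <= f x <= K) ->
  {homo f : x y / x <= y >-> y <= x} ->
  (forall s, (m1 (E `&` [set x | (x.1 <= s)%R]) <=
              m2 (E `&` [set x | (x.1 <= s)%R]))%E) ->
  (\int[m1]_(x in E) (f x.1)%:E <= \int[m2]_(x in E) (f x.1)%:E)%E.
Proof.
move=> mE fK fd lE; apply: (le_integral_superlevel _ _ m1oo m2oo E K) => //.
  apply: (@measurableT_comp _ _ _ _ _ _ f) => //.
  exact: nonincreasing_measurable.
move=> r; apply: (le_measure_down_closed m1 m2 E fst [set x | r <= f x]) => //.
by move=> x y xy /= rf; apply: (le_trans rf); exact: fd.
Qed.

Variable u : R -> R -> R.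
Hypotheses (und : nondecreasing2 u) (udd : decreasing_differences u)
  (uc : forall s, continuous (u s)).

Lemma measurable_clamped (a1 b1 a2 b2 : R) : a1 <= b1 -> a2 <= b2 ->
  measurable_fun setT (fun x : R * R => u (clamp a1 b1 x.1) (clamp a2 b2 x.2)).
Proof.
move=> ab1 ab2.
apply: (measurable_section_comp a2 b2
  (fun x t => u (clamp a1 b1 x.1) (clamp a2 b2 t)) snd) => //.
- move=> t; apply: (@measurableT_comp _ _ _ _ _ _
    (fun s => u (clamp a1 b1 s) (clamp a2 b2 t))) => //.
  apply: nondecreasing_measurable => // s s' ss.
  by apply und => //; exact: clamp_le.
- move=> x t; apply: continuous_comp; [exact: continuous_clamp|exact: uc].
- by move=> x t; rewrite clampK.
Qed.

Lemma clamped_cvg (a1 b1 a2 b2 : nat -> R) (x : R * R) :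
  (forall n, [/\ a1 n <= - n%:R, n%:R <= b1 n, a2 n <= - n%:R & n%:R <= b2 n]) ->
  (fun n => u (clamp (a1 n) (b1 n) x.1) (clamp (a2 n) (b2 n) x.2)) @ \oo -->
  u x.1 x.2.
Proof.
move=> ab; apply: cvg_near_cst.
near=> n; have [h1 h2 h3 h4] := ab n.
have n1 : `|x.1| <= n%:R by near: n; exact: nbhs_infty_ger.
have n2 : `|x.2| <= n%:R by near: n; exact: nbhs_infty_ger.
rewrite ler_norml in n1; rewrite ler_norml in n2.
by rewrite !clamp_id//; lra.
Unshelve. all: by end_near. Qed.

Lemma measurable_uncurried : measurable_fun setT (fun x : R * R => u x.1 x.2).
Proof.
apply: (@measurable_fun_cvg _ _ _ _ (fun (n : nat) (x : R * R) =>
  u (clamp (- n%:R) n%:R x.1) (clamp (- n%:R) n%:R x.2))).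
  move=> n; have n0 : - n%:R <= n%:R :> R by have := ler0n R n; lra.
  exact: measurable_clamped.
by move=> x _; exact: (clamped_cvg (fun n => - n%:R) (fun n => n%:R)
  (fun n => - n%:R) (fun n => n%:R)).
Qed.

Lemma le_integral_clamped (a1 b1 a2 b2 : R) : a1 <= b1 -> a2 <= b2 ->
  (\int[m2]_x (u (clamp a1 b1 x.1) (clamp a2 b2 x.2))%:E <=
   \int[m1]_x (u (clamp a1 b1 x.1) (clamp a2 b2 x.2))%:E)%E.
Proof.
move=> ab1 ab2; pose U s t := u (clamp a1 b1 s) (clamp a2 b2 t).
(* Subtracting from the maximum [M] yields a nonnegative nonincreasing integrand bounded by the
   oscillation [K]; the inequality reverses accordingly. *)
pose M := u b1 b2; pose K := M - u a1 a2.
have Und s s' t t' : s <= s' -> t <= t' -> U s t <= U s' t'.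
  by move=> ss tt; apply und; exact: clamp_le.
have UM s t : u a1 a2 <= U s t <= M.
  by apply/andP; split; apply und; have := clamp_bounds _ _ _ s ab1;
    have := clamp_bounds _ _ _ t ab2; lra.
have mU : measurable_fun setT (fun x : R * R => U x.1 x.2).
  exact: measurable_clamped.
have mUt t : measurable_fun setT (fun x : R * R => U x.1 t).
  apply: (@measurableT_comp _ _ _ _ _ _ (U^~ t)) => //.
  by apply: nondecreasing_measurable => // s s' ss; exact: Und.
have leMU : (\int[m1]_x (M - U x.1 x.2)%:E <= \int[m2]_x (M - U x.1 x.2)%:E)%E.
  apply: (le_integral_staircase _ _ m1oo m2oo setT a2 b2 K
    (fun x t => M - U x.1 t) snd) => //.
  - by move=> t; exact: measurable_funB.
  - by move=> x t; rewrite /K; have := UM x.1 t; lra.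
  - by move=> x s t st; rewrite lerD2l lerN2; exact: Und.
  - move=> x t; apply: (@continuousB _ _ _ (cst M) (U x.1)); first exact: cvg_cst.
    by apply: continuous_comp; [exact: continuous_clamp|exact: uc].
  - by move=> x t; rewrite /U clampK.
  - apply: (le_integral_marginal setT K (fun s => M - U s b2)) => //.
    + by move=> s; rewrite /K; have := UM s b2; lra.
    + by move=> s s' ss; rewrite lerD2l lerN2; exact: Und.
    + exact: le_orthant_fst.
  (* Decreasing differences enter here: the increment of [U] from [s] to [t] is nonincreasing in the
     first coordinate. *)
  - move=> s t st.
    have -> : (fun x : R * R => (M - U x.1 s - (M - U x.1 t))%:E) =
              (fun x => (U x.1 t - U x.1 s)%:E).
      by apply/funext => x; congr EFin; ring.
    rewrite setTI.
    apply: (le_integral_marginal _ K (fun x => U x t - U x s)).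
    + exact: measurable_fun_le_cst.
    + by move=> x; rewrite /K; have := UM x t; have := UM x s;
        have := Und _ _ _ _ (lexx x) st; lra.
    + move=> x y xy; have := udd _ _ _ _ (clamp_le _ _ _ _ _ ab1 xy)
        (clamp_le _ _ _ _ _ ab2 st).
      by rewrite /U; lra.
    + by move=> r; exact: le_orthant_snd_fst.
have iM (m : {measure set (R * R) -> \bar R}) : (m setT < +oo)%E ->
    m.-integrable setT (EFin \o cst M).
  by move=> moo; exact: (bounded_integrable m setT (cst M) `|M|).
have iU (m : {measure set (R * R) -> \bar R}) : (m setT < +oo)%E ->
    m.-integrable setT (fun x => (U x.1 x.2)%:E).
  move=> moo; apply: (bounded_integrable m setT (fun x => U x.1 x.2)
    (`|M| + `|u a1 a2|)) => // x.
  have := UM x.1 x.2; have := ler_norm M; have := ler_norm (- u a1 a2).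
  by rewrite normrN ler_norml; have := normr_ge0 M;
    have := normr_ge0 (u a1 a2); lra.
have fU (m : {measure set (R * R) -> \bar R}) : (m setT < +oo)%E ->
    (\int[m]_x (M - U x.1 x.2)%:E = M%:E * m setT - \int[m]_x (U x.1 x.2)%:E)%E.
  move=> moo; under eq_integral => x _ do rewrite EFinB.
  rewrite (integralB_EFin measurableT (iM m moo) (iU m moo)).
  by congr (_ - _)%E; exact: (integral_cst m measurableT M%:E).
(* Equal total masses make the contributions of [M] cancel. *)
move: leMU; rewrite !fU// m12 leeD2lE ?leeN2//.
by rewrite fin_numM// fin_num_abs gee0_abs.
Qed.

Lemma le_integral_lower_orthant :
  m1.-integrable setT (fun x => (u x.1 x.2)%:E) ->
  m2.-integrable setT (fun x => (u x.1 x.2)%:E) ->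
  (\int[m2]_x (u x.1 x.2)%:E <= \int[m1]_x (u x.1 x.2)%:E)%E.
Proof.
move=> i1 i2; have [C CP] := dominating_boxes u und udd uc.
have /choice[ab abP] : forall n : nat, exists ab : (R * R) * (R * R),
    [/\ ab.1.1 <= - n%:R, n%:R <= ab.1.2, ab.2.1 <= - n%:R, n%:R <= ab.2.2 &
    forall x1 x2, `|u (clamp ab.1.1 ab.1.2 x1) (clamp ab.2.1 ab.2.2 x2)| <=
                  `|u x1 x2| + C].
  move=> n; have [a1 [b1 [a2 [b2 h]]]] := CP n%:R (ler0n R n).
  by exists ((a1, b1), (a2, b2)).
have ab1 n : (ab n).1.1 <= (ab n).1.2.
  by have [h1 h2 _ _ _] := abP n; have := ler0n R n; lra.
have ab2 n : (ab n).2.1 <= (ab n).2.2.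
  by have [_ _ h1 h2 _] := abP n; have := ler0n R n; lra.
pose U n (x : R * R) :=
  u (clamp (ab n).1.1 (ab n).1.2 x.1) (clamp (ab n).2.1 (ab n).2.2 x.2).
have cvgU (m : {measure set (R * R) -> \bar R}) : (m setT < +oo)%E ->
    m.-integrable setT (fun x => (u x.1 x.2)%:E) ->
    (fun n => \int[m]_x (U n x)%:E)%E @ \oo --> (\int[m]_x (u x.1 x.2)%:E)%E.
  move=> moo im.
  (* The dominating function is [|u| + C], integrable since the mass is finite; at each point the
     truncation is eventually exact. *)
  have [| | | | |_ _] := @dominated_convergence _ _ R m setT measurableT
    (fun n x => (U n x)%:E) (fun x => (u x.1 x.2)%:E)
    ((abse \o (fun x => (u x.1 x.2)%:E)) \+ (EFin \o cst C))%E.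
  - by move=> n; apply/measurable_EFinP; exact: measurable_clamped.
  - by apply/measurable_EFinP; exact: measurable_uncurried.
  - apply: aeW => x _; apply: cvg_EFin; first exact: nearW.
    apply: (clamped_cvg (fun n => (ab n).1.1) (fun n => (ab n).1.2)
      (fun n => (ab n).2.1) (fun n => (ab n).2.2)) => n.
    by have [? ? ? ? _] := abP n.
  - apply: integrableD => //; first exact: integrable_abse.
    exact: (bounded_integrable m setT (cst C) `|C|).
  - apply: aeW => x n _; rewrite /= -EFinD lee_fin.
    by have [_ _ _ _] := abP n; exact.
  by [].
apply: (lee_cvg_to (cvgU _ m2oo i2) (cvgU _ m1oo i1)).
by apply: nearW => n; exact: le_integral_clamped.
Qed.

End lower_orthant.

(** * Strictness *)

(* The measure structure on [pushforward m f] takes the measurability of [f] as an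
   argument that unification cannot find. *)
Definition image_measure {d1 d2} {T1 : measurableType d1} {T2 : measurableType d2}
    {R : realType} (m : {measure set T1 -> \bar R}) (f : T1 -> T2)
    (mf : measurable_fun setT f) : {measure set T2 -> \bar R} :=
  ltac:(refine (pushforward m f : {measure set T2 -> \bar R}); exact: mf).

Lemma law_with_atom {d} {T : measurableType d} {R : realType}
    (P : probability T R) (X1 X2 : {RV P >-> R}) (eta : {nonneg R}) (a : R * R) :
  exists m : {measure set (R * R) -> \bar R},
    [/\ forall s t, (m [set x | (x.1 <= s)%R /\ (x.2 <= t)%R] =
          cdf2 P X1 X2 s t + (eta%:num * ((a.1 <= s)%R && (a.2 <= t)%R)%:R)%:E)%E,
        (m setT = 1 + eta%:num%:E)%E &
        forall f : R * R -> R, measurable_fun setT f ->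
          P.-integrable setT (fun w => (f (X1 w, X2 w))%:E) ->
          m.-integrable setT (EFin \o f) /\
          (\int[m]_x (f x)%:E =
           \int[P]_w (f (X1 w, X2 w))%:E + (eta%:num * f a)%:E)%E].
Proof.
have mX : measurable_fun setT (fun w => (X1 w, X2 w)).
  by apply: measurable_fun_pair; exact: measurable_funPT.
pose mu1 := image_measure P _ mX.
have mc : measurable_fun setT (cst a : T -> R * R) by exact: measurable_cst.
(* The atom at [a] is the image of [eta] times [P] under a constant map, so both summands are
   handled as pushforwards. *)
pose mu2 := image_measure (mscale eta P) _ mc.
have etaPT : (mscale eta P setT = eta%:num%:E)%E.
  transitivity (eta%:num%:E * P setT)%E; first by [].
  by rewrite probability_setT mule1.
have mu2E A : (mu2 A = (eta%:num * (a \in A)%:R)%:E)%E.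
  rewrite /mu2/= /pushforward /mscale/= preimage_cst; case: ifPn => _.
    by rewrite probability_setT mule1 mulr1.
  by rewrite measure0 mule0 mulr0.
pose m : {measure set (R * R) -> \bar R} := measure_add mu1 mu2.
have mE A : m A = (mu1 A + mu2 A)%E by exact: measure_addE.
exists m; split.
- move=> s t; rewrite mE mu2E; congr (_ + (_ * _)%:E)%E.
  congr ((nat_of_bool _)%:R); apply/idP/idP; first by rewrite inE => -[-> ->].
  by move=> /andP[? ?]; rewrite inE.
- rewrite mE mu2E in_setT mulr1; congr (_ + _)%E.
  exact: probability_setT.
move=> f mf iX.
have mf' : measurable_fun setT (EFin \o f) by exact/measurable_EFinP.
have i1 : mu1.-integrable setT (EFin \o f) by exact: integrable_pushforward.
have i2' : (mscale eta P).-integrable setT ((EFin \o f) \o cst a).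
  apply: (bounded_integrable _ setT (cst (f a)) `|f a|) => //.
  by rewrite [ltLHS]etaPT ltry.
have i2 : mu2.-integrable setT (EFin \o f) by exact: integrable_pushforward.
split.
  apply/integrableP; split => //; rewrite ge0_integral_measure_add//; last first.
    exact: measurableT_comp.
  by apply: lte_add_pinfty; [case/integrableP: i1|case/integrableP: i2].
rewrite (integral_measure_add measurableT i1 i2); congr (_ + _)%E.
  by rewrite integral_pushforward.
rewrite integral_pushforward// preimage_setT.
rewrite (integral_cst (mscale eta P) measurableT (f a)%:E).
by rewrite [X in (_ * X)%E]etaPT -EFinM mulrC.
Qed.

Lemma cdf1E {d} {T : measurableType d} {R : realType} (P : probability T R)
  (X : {RV P >-> R}) v : cdf1 P X v = cdf X v.
Proof. by rewrite /cdf /distribution /pushforward. Qed.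

Lemma le_cdf2 {d} {T : measurableType d} {R : realType} (P : probability T R)
    (X1 X2 : {RV P >-> R}) s s' t t' : s <= s' -> t <= t' ->
  (cdf2 P X1 X2 s t <= cdf2 P X1 X2 s' t')%E.
Proof.
have mX r r' : measurable [set w | X1 w <= r /\ X2 w <= r'].
  by apply: measurableI; exact: measurable_fun_le_cst.
move=> ss tt; apply: le_measure; rewrite ?inE//.
by move=> w /= [h1 h2]; split; [exact: le_trans ss|exact: le_trans tt].
Qed.

Lemma le_cdf2_cdf1 {d} {T : measurableType d} {R : realType}
    (P : probability T R) (X1 X2 : {RV P >-> R}) s s' t : s <= s' ->
  (cdf2 P X1 X2 s t <= cdf1 P X1 s')%E.
Proof.
move=> ss; apply: le_measure; rewrite ?inE.
- by apply: measurableI; exact: measurable_fun_le_cst.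
- exact: measurable_fun_le_cst.
- by move=> w /= [h1 _]; exact: le_trans ss.
Qed.

Lemma cvg_cdf2_cdf1 {d} {T : measurableType d} {R : realType}
    (P : probability T R) (X1 X2 : {RV P >-> R}) s :
  (fun n : nat => cdf2 P X1 X2 s n%:R) @ \oo --> cdf1 P X1 s.
Proof.
pose F (n : nat) := [set w | X1 w <= s /\ X2 w <= n%:R].
have mF n : measurable (F n).
  by apply: measurableI; exact: measurable_fun_le_cst.
have -> : cdf1 P X1 s = P (\bigcup_n F n).
  congr (P _); apply/seteqP; split=> w; last by move=> [n _ []].
  move=> ws; exists (Num.truncn (X2 w)).+1 => //; split => //.
  exact/ltW/truncnS_gt.
apply: (@nondecreasing_cvg_mu _ _ _ P F mF (bigcupT_measurable F mF)).
move=> i j ij; apply/subsetPset => w /= [h1 h2]; split => //.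
by apply: (le_trans h2); rewrite ler_nat.
Qed.

(* A strict gap between the first marginals at v leaves room to add mass eta to
   the law of X at (v, t0) and to the law of Y at the larger point (v', t0). *)
Lemma cdf_gap {d} {T : measurableType d} {R : realType} (P : probability T R)
    (X1 X2 Y1 Y2 : {RV P >-> R}) (v : R) :
  fsd2_ge P X1 X2 Y1 Y2 -> (cdf1 P X1 v < cdf1 P Y1 v)%E ->
  exists v' t0 (eta : {nonneg R}), [/\ v < v', 0 < eta%:num &
    forall s t,
      (cdf2 P X1 X2 s t + (eta%:num * ((v <= s)%R && (t0 <= t)%R)%:R)%:E <=
       cdf2 P Y1 Y2 s t + (eta%:num * ((v' <= s)%R && (t0 <= t)%R)%:R)%:E)%E].
Proof.
move=> XY lt_v.
(* Right continuity of the marginal distribution function lets the gap survive a shift from [v] to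
   [v']. *)
have [v' vv' lt_v'] : exists2 v', v < v' & (cdf1 P X1 v' < cdf1 P Y1 v)%E.
  have nearlt : \forall x \near v^'+, (cdf X1 x < cdf1 P Y1 v)%E.
    have nlt : nbhs (cdf X1 v) [set y | (y < cdf1 P Y1 v)%E].
      apply: open_nbhs_nbhs; split; first exact: open_ereal_lt_ereal.
      by rewrite /= -cdf1E.
    exact: (@cdf_right_continuous _ _ _ P X1 v) nlt.
  near v^'+ => x; exists x; first by near: x; exact: nbhs_right_gt.
  by rewrite cdf1E; near: x.
have [t0 lt_t0] : exists t0, (cdf1 P X1 v' < cdf2 P Y1 Y2 v t0)%E.
  apply: contrapT => /forallNP h.
  suff : (cdf1 P Y1 v <= cdf1 P X1 v')%E by rewrite leNgt lt_v'.
  apply: (lee_cvg_to (cvg_cdf2_cdf1 P Y1 Y2 v) (cvg_cst _)).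
  by apply: nearW => n; rewrite leNgt; apply/negP/h.
have fin1 (Z : {RV P >-> R}) r : cdf1 P Z r \is a fin_num.
  by apply: fin_num_measure; exact: measurable_fun_le_cst.
have fin2 (Z1 Z2 : {RV P >-> R}) r r' : cdf2 P Z1 Z2 r r' \is a fin_num.
  by apply: fin_num_measure; apply: measurableI; exact: measurable_fun_le_cst.
(* The atom mass is the gap itself. The delicate case is [v <= s < v'] with [t0 <= t], where only
   the left side is charged: there [cdf2 P X1 X2 s t] is at most [cdf1 P X1 v'], and adding [e]
   gives at most [cdf2 P Y1 Y2 v t0], hence at most [cdf2 P Y1 Y2 s t]. *)
pose e := fine (cdf2 P Y1 Y2 v t0) - fine (cdf1 P X1 v').
have e0 : 0 < e by rewrite subr_gt0 fine_lt.
exists v', t0, (NngNum (ltW e0)); split => //= s t.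
have := XY s t; have := le_cdf2 P Y1 Y2 v s t0 t.
have := le_cdf2_cdf1 P X1 X2 s v' t; move: lt_t0 e0; rewrite /e.
rewrite -(fineK (fin1 X1 v')) -(fineK (fin2 X1 X2 s t)) -(fineK (fin2 Y1 Y2 s t)).
rewrite -(fineK (fin2 Y1 Y2 v t0)) -!EFinD !lee_fin lte_fin/=.
have [v's|sv'] := leP v' s.
  have -> : v <= s by lra.
  by have [t0t|tt0] := leP t0 t => /=; lra.
have [vs|sv] := leP v s; have [t0t|tt0] := leP t0 t => /=; lra.
Unshelve. all: by end_near. Qed.

Theorem theorem3p2 (d : measure_display) (T : measurableType d) (R : realType)
  (P : probability T R) (X1 X2 Y1 Y2 : {RV P >-> R}) (u : R -> R -> R) :
  dist_dom P X1 X2 Y1 Y2 ->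
  strictly_increasing2 u ->
  mixed_partial_nonpos u ->
  P.-integrable setT (fun w => (u (X1 w) (X2 w))%:E) ->
  P.-integrable setT (fun w => (u (Y1 w) (Y2 w))%:E) ->
  ('E_P[fun w => u (Y1 w) (Y2 w)] < 'E_P[fun w => u (X1 w) (X2 w)])%E.
Proof.
move=> [XY XY1] uincr um iX iY.
have und := strictly_increasing2_nondecreasing u uincr.
have udd := mixed_partial_nonpos_decreasing_differences u um.
have uc := mixed_partial_nonpos_continuous u um.
have [p [q [eta [upq eta0 bump]]]] : exists p q (eta : {nonneg R}),
    [/\ u p.1 p.2 < u q.1 q.2, 0 < eta%:num & forall s t,
      (cdf2 P X1 X2 s t + (eta%:num * ((p.1 <= s)%R && (p.2 <= t)%R)%:R)%:E <=
       cdf2 P Y1 Y2 s t + (eta%:num * ((q.1 <= s)%R && (q.2 <= t)%R)%:R)%:E)%E].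
  case: XY1 => -[_ [v lt_v]].
    have [v' [t0 [eta [vv' eta0 H]]]] := cdf_gap P X1 X2 Y1 Y2 v XY lt_v.
    exists (v, t0), (v', t0), eta; split => //.
    by apply: uincr; split; [exact: ltW|split => //; left].
  (* A gap in the second marginal is treated by exchanging the coordinates. *)
  have cdf2C (Z1 Z2 : T -> R) s t : cdf2 P Z2 Z1 t s = cdf2 P Z1 Z2 s t.
    by congr (P _); apply/seteqP; split => w /= [].
  have YX : fsd2_ge P X2 X1 Y2 Y1.
    by move=> t s; rewrite (cdf2C X1) (cdf2C Y1); exact: XY.
  have [v' [t0 [eta [vv' eta0 H]]]] := cdf_gap P X2 X1 Y2 Y1 v YX lt_v.
  exists (t0, v), (t0, v'), eta; split => //.
    by apply: uincr; split => //; split; [exact: ltW|right].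
  by move=> s t; have := H t s; rewrite (cdf2C X1) (cdf2C Y1)/= !(andbC (t0 <= s)).
have [m1 [m1Q m1T m1I]] := law_with_atom P X1 X2 eta p.
have [m2 [m2Q m2T m2I]] := law_with_atom P Y1 Y2 eta q.
have mu := measurable_uncurried u und uc.
have [i1 I1] := m1I (fun x => u x.1 x.2) mu iX.
have [i2 I2] := m2I (fun x => u x.1 x.2) mu iY.
have : (\int[m2]_x (u x.1 x.2)%:E <= \int[m1]_x (u x.1 x.2)%:E)%E.
  apply: le_integral_lower_orthant => //.
  - by move=> s t; rewrite m1Q m2Q; exact: bump.
  - by rewrite m1T -EFinD ltry.
  - by rewrite m1T m2T.
rewrite I1 I2 /= !unlock.
have fX := integrable_fin_num measurableT iX.
have fY := integrable_fin_num measurableT iY.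
rewrite -(fineK fX) -(fineK fY) -!EFinD lee_fin lte_fin.
(* The weak inequality now reads [E u(Y) + eta * u(q) <= E u(X) + eta * u(p)], and [u(p) < u(q)]
   makes it strict once the atoms are removed. *)
have : eta%:num * u p.1 p.2 < eta%:num * u q.1 q.2 by rewrite ltr_pM2l.
lra.
Qed.
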